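(* Let $\mathcal{S}:[0,1]\to\mathbb{R}_{>0}$ be continuous and convex. Let $u_{\mathrm{TP}}$ be the threshold policy given by $u_{\mathrm{TP}}(t)=\mathrm{ON}$ if $x(t)\le x_{\mathrm{th}}(\tau)$ and $u_{\mathrm{TP}}(t)=\mathrm{OFF}$ otherwise. For any $\tau>0$, $x_0\in[0,1]$, $n_0\in\mathbb{N}$ and $0<\lambda\le\lambda_{\mathrm{eq}}^{\max}(\tau)$, if $x_{\mathrm{th}}(\tau)<1$, then $$\limsup_{t\to+\infty} n_{u_{\mathrm{TP}}}(t,\tau,\lambda,x_0,n_0)<+\infty .$$
   Context: Dynamical queue. Identical tasks arrive periodically at a single server at rate $\lambda>0$ (a new task arrives every $1/\lambda$ time units) and are serviced in order of arrival. The server state $x(t)$ evolves by $\dot x(t)=(b(t)-x(t))/\tau$, $x(0)=x_0\in[0,1]$, where $\tau>0$ and $b(t)=1$ if the server is busy at time $t$ and $b(t)=0$ otherwise; $[0,1]$ is invariant. The service time function $\mathcal{S}:[0,1]\to\mathbb{R}_{>0}$ is continuous and convex: a task whose service begins when the server state is $x$ takes exactly time $\mathcal{S}(x)$ to service, during which the server is busy and cannot be interrupted. Task release control policy. A policy $u$ takes values $u(t)\in\{\mathrm{ON},\mathrm{OFF}\}$ for all $t\ge 0$; an outstanding task is assigned to the server if and only if the server is idle (not servicing a task) and $u=\mathrm{ON}$. No task is dropped. $n_u(t,\tau,\lambda,x_0,n_0)$ denotes the queue length, i.e. the number of outstanding tasks awaiting service, at time $t$ under policy $u$, when the arrival rate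 is $\lambda$ and at time $0$ the server state is $x_0$ and the queue length is $n_0$. One-task equilibrium. For $x\in[0,1]$, $\tau>0$, $\lambda>0$ let $\mathcal{R}(x,\tau,\lambda):=\tau\log\bigl(1-(1-e^{1/(\lambda\tau)})x\bigr)$ and $x_{\mathrm{eq}}(\tau,\lambda):=\{x\in[0,1] : \mathcal{S}(x)=\mathcal{R}(x,\tau,\lambda)\}$. Define $\lambda_{\mathrm{eq}}^{\max}(\tau):=\max\{\lambda>0 : x_{\mathrm{eq}}(\tau,\lambda)\neq\emptyset\}$ (the maximum exists). The set $x_{\mathrm{eq}}(\tau,\lambda_{\mathrm{eq}}^{\max}(\tau))$ has exactly one element, denoted $x_{\mathrm{th}}(\tau)$. *)

(* Defs.v *)
From HB Require Import structures.
From mathcomp Require Import all_boot all_order all_algebra.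
From mathcomp Require Import finmap.
From mathcomp Require Import all_classical all_reals all_analysis.

Set Implicit Arguments.
Unset Strict Implicit.
Unset Printing Implicit Defensive.

Import Order.TTheory GRing.Theory Num.Theory.
Import numFieldNormedType.Exports.

Local Open Scope classical_set_scope.
Local Open Scope ring_scope.

(* A service time function is a total [S : R -> R] of which only the values on
   [0, 1] matter. *)

Definition equilibrium_time (R : realType) (x tau lam : R) : R :=
  tau * ln (1 - (1 - expR (1 / (lam * tau))) * x).

Definition x_eq (R : realType) (S : R -> R) (tau lam : R) : set R :=
  [set x | x \in `[0, 1] /\ S x = equilibrium_time x tau lam].

Definition equilibrium_rates (R : realType) (S : R -> R) (tau : R) : set R :=
  [set lam | 0 < lam /\ x_eq S tau lam !=set0].

(* [A `&` ubound A] consists of the maximum of [A], if there is one. The default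
   value 0 of [xget] is irrelevant for continuous, convex, positive [S], since
   the maximum then exists; likewise for the singleton defining [x_th]. *)
Definition lambda_eq_max (R : realType) (S : R -> R) (tau : R) : R :=
  xget 0 (equilibrium_rates S tau `&` ubound (equilibrium_rates S tau)).

Definition x_th (R : realType) (S : R -> R) (tau : R) : R :=
  xget 0 (x_eq S tau (lambda_eq_max S tau)).

(* Below, [x : R -> R] is the trajectory of the server state and [starts] is the
   set of times at which the service of some task begins. *)

(* Times at which the server is busy, a service occupying [s, s + S (x s)[. *)
Definition busy (R : realType) (S x : R -> R) (starts : set R) : set R :=
  \bigcup_(s in starts) `[s, s + S (x s)[%classic.

(* Times at which a service begun strictly earlier is still in progress: the
   server cannot accept a task at such times. It is available at time [s] for
   the service beginning at [s], and at the time at which a service ends. *)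
Definition occupied (R : realType) (S x : R -> R) (starts : set R) : set R :=
  \bigcup_(s in starts) `]s, s + S (x s)[%classic.

(* The arrivals occur at times 1 / lam, 2 / lam, 3 / lam, ...: this is the number
   of them in ]0, t]. *)
Definition arrivals (R : realType) (lam t : R) : nat := Num.truncn (lam * t).

(* Number of tasks outstanding at time [t], before and after a possible
   assignment at [t]. In a run (see below) the services begun by time [t] are
   finite in number and at most as many as the tasks that have arrived, so that
   [fset_set] and the truncated subtraction are harmless. *)
Definition outstanding (R : realType) (lam : R) (n0 : nat) (starts : set R)
    (t : R) : nat :=
  (n0 + arrivals lam t - #|` fset_set (starts `&` `[0%R, t[)|)%N.

Definition queue_length (R : realType) (lam : R) (n0 : nat) (starts : set R)
    (t : R) : nat :=
  (n0 + arrivals lam t - #|` fset_set (starts `&` `[0%R, t])|)%N.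

(* [u t] means that the policy is ON at time [t]. The server is idle and in state
   [x0] at time 0, with [n0] tasks outstanding. As the input
   [\1_(busy S x starts)] is piecewise constant, a solution of the differential
   equation is a continuous function satisfying it at all times other than the
   jumps of the input. *)
Record dynamical_queue_run (R : realType) (S : R -> R) (tau lam x0 : R)
    (n0 : nat) (u : R -> bool) (x : R -> R) (starts : set R) : Prop := {
  run_init : x 0 = x0 ;
  run_state : forall t, 0 <= t -> x t \in `[0, 1] ;
  run_continuous : {within `[0, +oo[, continuous x} ;
  run_ode : forall t : R, 0 < t ->
    (\forall s \near t,
       \1_(busy S x starts) s = \1_(busy S x starts) t :> R) ->
    is_derive t (1 : R) x ((\1_(busy S x starts) t - x t) / tau) ;
  run_assign : forall t, starts t <->
    [/\ 0 <= t, ~ occupied S x starts t,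
        (0 < outstanding lam n0 starts t)%N & u t]
}.

Definition threshold_policy (R : realType) (S : R -> R) (tau : R) (x : R -> R) :
  R -> bool := fun t => x t <= x_th S tau.

(* Main.v *)
(** Let [L] be the maximal equilibrium rate and [th < 1] the threshold. Since
    [S 0 > 0], also [th > 0]. While tasks are queued, a server found below [th]
    works without pause; each service multiplies [1 - x] by at most a fixed
    factor below 1, so after a bounded time [x] exceeds [th] at the end of a
    service and then decays to exactly [th], where the next service starts.
    From there on the one-task equilibrium equation says that service plus
    decay back to [th] takes exactly [1 / L], so the services started while
    the queue is nonempty keep up with the arrivals, up to a bounded loss.
    The bound on the queue follows by looking back to the last time at which
    it was empty. *)

Require Import Defs.
From HB Require Import structures.
From mathcomp Require Import all_boot all_order all_algebra.
From mathcomp Require Import all_classical all_reals all_analysis.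
From mathcomp Require Import finmap lra ring.

Import Order.TTheory GRing.Theory Num.Theory.
Import numFieldNormedType.Exports.

Local Open Scope classical_set_scope.
Local Open Scope ring_scope.

(** The integrating factor [expR (t / tau)] turns [x - c] into a function with zero derivative
    inside the interval, so the mean value theorem equates its end values. The equation is assumed
    only on the open interval, since the input may jump at [a] and [b]. *)
Lemma relaxation_solution (R : realType) (tau c a b : R) (x : R -> R) :
  tau != 0 -> a <= b -> {within `[a, b], continuous x} ->
  (forall t : R, a < t < b -> is_derive t (1 : R) x ((c - x t) / tau)) ->
  x b = c + (x a - c) * expR (- ((b - a) / tau)).
Proof.
move=> tau0 ab xc xd.
pose h := fun t : R => expR (t / tau).
have dh t : is_derive t (1 : R) h (h t / tau).
  have dl : is_derive t (1 : R) (fun y : R => y / tau) tau^-1.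
    have H := @is_deriveM R R id (cst tau^-1) t 1 1 0 (is_derive_id _ _)
      (is_derive_cst _ _ _).
    apply: is_derive_eq H _.
    by rewrite scaler0 add0r -[LHS]/(tau^-1 * 1) mulr1.
  exact: (@is_derive1_comp R expR (fun y : R => y / tau) t _ _
    (is_derive_expR (t / tau)) dl).
pose g := (x - cst c) * h.
have hc : {within `[a, b], continuous h}.
  apply: continuous_subspaceT => t.
  by apply: differentiable_continuous; apply/derivable1_diffP; exact: ex_derive.
have gc : {within `[a, b], continuous g}.
  move=> t; apply: cvgM; last exact: hc.
  apply: cvgB; first exact: xc.
  exact: cvg_cst.
have gd t : t \in `]a, b[ -> is_derive t (1 : R) g 0.
  rewrite in_itv/= => /xd dx.
  have dxc := is_deriveB dx (is_derive_cst c t (1 : R)).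
  have H := is_deriveM dxc (dh t).
  apply: is_derive_eq H _.
  rewrite -![_ *: _]/(_ * _) /= /cst /=.
  rewrite -[(x - _) t]/(x t - c).
  by field.
have [e _] := MVT_segment ab gd gc.
rewrite mul0r => /eqP; rewrite subr_eq0 => /eqP.
rewrite -[g b]/((x b - c) * expR (b / tau)) -[g a]/((x a - c) * expR (a / tau)).
move=> H.
have -> : - ((b - a) / tau) = a / tau - b / tau by field.
rewrite expRD mulrA -H expRN mulfK ?gt_eqF ?expR_gt0//; ring.
Qed.

(** * Runs of the queue under an arbitrary policy *)

Section QueueRun.
Set Implicit Arguments.
Unset Strict Implicit.
Unset Printing Implicit Defensive.

Variables (R : realType) (S : R -> R) (tau lam x0 : R) (n0 : nat).
Variables (u : R -> bool) (x : R -> R) (starts : set R) (m : R).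
Hypothesis tau_gt0 : 0 < tau.
Hypothesis run : dynamical_queue_run S tau lam x0 n0 u x starts.
Hypothesis m_gt0 : 0 < m.
Hypothesis S_ge : forall y : R, y \in `[0, 1] -> m <= S y.

Definition available (t : R) : Prop := 0 <= t /\ ~ occupied S x starts t.

Lemma start_available s : starts s -> available s.
Proof. by move=> /(run_assign run)[]. Qed.

Lemma start_ge0 s : starts s -> 0 <= s.
Proof. by move=> /start_available[]. Qed.

Lemma service_ge s : starts s -> m <= S (x s).
Proof. by move=> /start_ge0 s0; apply/S_ge/(run_state run). Qed.

Lemma service_gt0 s : starts s -> 0 < S (x s).
Proof. by move=> /service_ge; apply: lt_le_trans. Qed.

Lemma available_service_end s t :
  available t -> starts s -> s < t -> s + S (x s) <= t.
Proof.
move=> [_ nocc] ss st; rewrite leNgt; apply/negP => tS; apply: nocc.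
by exists s => //=; rewrite in_itv/= st tS.
Qed.

Lemma starts_separated s t : starts s -> starts t -> s < t -> s + m <= t.
Proof.
move=> ss st lt.
apply: le_trans (available_service_end (start_available st) ss lt).
by rewrite lerD2l service_ge.
Qed.

Lemma service_end_available s : starts s -> available (s + S (x s)).
Proof.
move=> ss; have Ss := service_gt0 ss; split.
  by have := start_ge0 ss; lra.
move=> [t /= ts]; rewrite in_itv/= => /andP[lt1 lt2].
have [lt|lt|eq] := ltgtP t s.
- have := available_service_end (start_available ss) ts lt; lra.
- have := available_service_end (start_available ts) ss lt; lra.
- move: lt2; rewrite eq; lra.
Qed.

Lemma first_start r s : starts s -> r <= s ->
  exists s0, [/\ starts s0, r <= s0, s0 <= s &
    forall t, starts t -> r <= t -> s0 <= t].
Proof.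
move=> ss rs.
have [k] : exists k : nat, s < r + k%:R * m.
  exists (Num.truncn ((s - r) / m)).+1.
  by rewrite -ltrBlDl -ltr_pdivrMr// truncnS_gt.
elim: k s ss rs => [|k IH] s ss rs; first by rewrite mul0r addr0 ltNge rs.
rewrite -natr1 mulrDl mul1r => sk.
have [[t [st rt ts]]|no] := pselect (exists t, [/\ starts t, r <= t & t < s]).
  have tm := starts_separated st ss ts; have m0 := m_gt0.
  have [|s0 [? ? ? ?]] := IH t st rt; first lra.
  by exists s0; split => //; apply: (le_trans _ (ltW ts)).
exists s; split => // t st rt; rewrite leNgt; apply/negP => ts.
by apply: no; exists t.
Qed.

Lemma finite_starts t : finite_set (starts `&` `[0, t]).
Proof.
(* Distinct starts differ by at least [m], so the integer parts of [s / m] tell them apart. *)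
pose f := fun s : R => Num.truncn (s / m).
have finj : {in starts `&` `[0, t] &, injective f}.
  have key s s' : starts s -> starts s' -> s < s' -> f s <> f s'.
    move=> ss ss' lt; have sep := starts_separated ss ss' lt.
    have s0 := start_ge0 ss; have s'0 := start_ge0 ss'.
    have /truncn_itv/andP[] : 0 <= s / m by rewrite divr_ge0// ltW.
    have /truncn_itv/andP[] : 0 <= s' / m by rewrite divr_ge0// ltW.
    rewrite -/(f s) -/(f s') => + + + _ eq; rewrite -eq => h1 h2 h3.
    move: h2 h3; rewrite -natr1 => h2 h3.
    have : s / m + 1 <= s' / m.
      by rewrite -(divff (lt0r_neq0 m_gt0)) -mulrDl ler_pM2r ?invr_gt0.
    lra.
  move=> s s' /set_mem[ss _] /set_mem[ss' _] eq.
  have [lt|lt|//] := ltgtP s s'; last by have := key _ _ ss' ss lt; rewrite eq.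
  by have := key _ _ ss ss' lt; rewrite eq.
rewrite -(eq_finite_set (inj_card_eq finj)).
apply: sub_finite_set (finite_II (f t).+1) => _ [s [ss +] <-].
rewrite /= in_itv/= => /andP[s0 st].
by rewrite ltnS; apply: le_truncn; rewrite ler_pM2r ?invr_gt0.
Qed.

Lemma state_within_continuous a b : 0 <= a -> {within `[a, b], continuous x}.
Proof.
move=> a0; apply: continuous_subspaceW (run_continuous run) => t /=.
by rewrite !in_itv/= andbT => /andP[at_ _]; exact: le_trans at_.
Qed.

Lemma state_relaxation (c : bool) a b : 0 <= a -> a <= b ->
  (forall t, a < t < b -> (\1_(busy S x starts) t : R) = c%:R) ->
  x b = c%:R + (x a - c%:R) * expR (- ((b - a) / tau)).
Proof.
move=> a0 ab bc; apply: relaxation_solution; rewrite ?gt_eqF//.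
  exact: state_within_continuous.
move=> t tab; rewrite -(bc _ tab).
apply: (run_ode run).
  by case/andP: tab => at_ _; exact: le_lt_trans at_.
have : t \in `]a, b[ by rewrite in_itv.
move=> /near_in_itvoo; apply: filterS => s.
by rewrite in_itv/= => /bc ->; rewrite (bc _ tab).
Qed.

(** Services begun before [a] are over by then and none begins before [b], so the input is 0 in
    between and the state decays freely. *)
Lemma state_idle a b : available a -> a <= b ->
  (forall s, starts s -> a <= s -> b <= s) ->
  x b = x a * expR (- ((b - a) / tau)).
Proof.
move=> ava ab nos; have [a0 _] := ava.
rewrite (@state_relaxation false a b) ?mulr0n ?add0r ?subr0//.
move=> t /andP[at_ tb].
rewrite indicE memNset// => -[s /= ss]; rewrite in_itv/= => /andP[st tS].
have [as_|sa] := leP a s.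
  by have := nos _ ss as_; lra.
by have := available_service_end ava ss sa; lra.
Qed.

Lemma available_idle a b : available a -> a <= b ->
  (forall s, starts s -> a <= s -> b <= s) -> available b.
Proof.
move=> ava ab nos; have [a0 _] := ava; split; first exact: le_trans ab.
move=> [s /= ss]; rewrite in_itv/= => /andP[sb bS].
have [as_|sa] := leP a s.
  by have := nos _ ss as_; lra.
by have := available_service_end ava ss sa; lra.
Qed.

Lemma state_service_end s : starts s ->
  x (s + S (x s)) = 1 + (x s - 1) * expR (- (S (x s) / tau)).
Proof.
move=> ss; have Ss := service_gt0 ss.
rewrite (@state_relaxation true s (s + S (x s))) ?mulr1n.
- by rewrite addrAC subrr add0r.
- exact: start_ge0.
- lra.
- move=> t /andP[st tS]; rewrite indicE mem_set//.
  by exists s => //=; rewrite in_itv/= (ltW st).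
Qed.

Lemma finite_starts_itv (i : interval R) t : [set` i] `<=` `[0, t] ->
  finite_set (starts `&` [set` i]).
Proof. by move=> it; exact: sub_finite_set (setIS it) (finite_starts t). Qed.

Lemma card_starts_cat a b t : a <= b -> a <= t -> 0 <= b ->
  (#|` fset_set (starts `&` `[0%R, a[)| + #|` fset_set (starts `&` `[b, t])|
   <= #|` fset_set (starts `&` `[0%R, t])|)%N.
Proof.
move=> ab at_ b0.
have sub1 : [set` `[0%R, a[] `<=` `[0%R, t].
  move=> s /=; rewrite !in_itv/= => /andP[-> sa].
  exact: ltW (lt_le_trans sa _).
have sub2 : [set` `[b, t]] `<=` `[0%R, t].
  by move=> s /=; rewrite !in_itv/= => /andP[bs ->]; rewrite (le_trans b0).
have fin1 := finite_starts_itv sub1; have fin2 := finite_starts_itv sub2.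
rewrite -cardfsUI -fset_setI// -fset_setU//.
rewrite (_ : _ `&` `[0%R, a[%classic `&` _ = set0) ?fset_set0 ?cardfs0 ?addn0.
  apply: fsubset_leq_card; rewrite -fset_set_sub ?finite_setU//.
    by rewrite -setIUr; apply: setIS; rewrite subUset.
  exact: finite_starts.
apply/seteqP; split => // s [[_ /=]]; rewrite in_itv/= => /andP[_ sa] [_ /=].
by rewrite in_itv/= => /andP[bs _]; lra.
Qed.

Lemma card_starts_progression (T a b r : R) k : 0 < T -> 0 <= a -> a <= r ->
  r + k%:R * T <= b -> (forall i, (i <= k)%N -> starts (r + i%:R * T)) ->
  (k < #|` fset_set (starts `&` `[a, b])|)%N.
Proof.
move=> T0 a0 ar rb st.
pose f := fun i : nat => r + i%:R * T.
have finj : {in `I_k.+1 &, injective f}.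
  move=> i j _ _ /addrI /(mulIf (lt0r_neq0 T0)) /eqP.
  by rewrite eqr_nat => /eqP.
rewrite -(card_fset_set (inj_card_eq finj)).
apply: fsubset_leq_card; rewrite -fset_set_sub.
- move=> _ [i /= ik <-]; split; first exact: st.
  rewrite /f /= in_itv/=; apply/andP; split.
    by rewrite (le_trans ar)// lerDl mulr_ge0// ltW.
  by rewrite (le_trans _ rb)// lerD2l ler_wpM2r ?(ltW T0)// ler_nat.
- exact: finite_image.
- apply: (@finite_starts_itv _ b) => s /=.
  by rewrite !in_itv/= => /andP[as_ ->]; rewrite (le_trans a0).
Qed.

(** * The threshold policy at a one-task equilibrium [th] of rate [L] *)

Variables (M th L : R).
Hypothesis S_le : forall y : R, y \in `[0, 1] -> S y <= M.
Hypothesis th_gt0 : 0 < th.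
Hypothesis th_lt1 : th < 1.
Hypothesis L_gt0 : 0 < L.
Hypothesis th_eq : S th = equilibrium_time th tau L.
Hypothesis u_th : forall t, u t = (x t <= th).

Lemma th_in01 : th \in `[0, 1].
Proof. by rewrite in_itv/= !ltW. Qed.

Lemma service_bound_ge0 : 0 <= M.
Proof.
apply: le_trans (S_le th_in01); apply: le_trans (ltW m_gt0) _.
exact: S_ge th_in01.
Qed.

Lemma decay_time_ge0 : 0 <= tau * ln th^-1.
Proof. by rewrite mulr_ge0 ?(ltW tau_gt0)// ln_ge0// invf_ge1 ?ltW. Qed.

Lemma expR_service_th :
  expR (S th / tau) = 1 - (1 - expR (1 / (L * tau))) * th.
Proof.
have E1 : 1 < expR (1 / (L * tau)) by rewrite expR_gt1 divr_gt0// mulr_gt0.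
rewrite th_eq /equilibrium_time mulrAC divff ?gt_eqF// [1 * ln _]mul1r lnK//.
have t0 := th_gt0.
by rewrite posrE; nra.
Qed.

(** * A time interval on which the queue stays nonempty *)

Section NonemptyQueue.
Variables a b : R.
Hypothesis a_ge0 : 0 <= a.
Hypothesis queued :
  forall s, a <= s <= b -> (0 < outstanding lam n0 starts s)%N.

Lemma start_of_available r :
  available r -> a <= r <= b -> x r <= th -> starts r.
Proof.
move=> [r0 nocc] rab xr; apply/(run_assign run).
by split; rewrite ?u_th ?queued.
Qed.

Let on_start r := starts r /\ x r = th.

(** Free decay from [x r] to [th] takes time [tau * ln (x r / th)]. Before that the policy is OFF;
    at that instant it turns ON, as the threshold inequality is not strict. *)
Lemma start_after_decay r : available r -> a <= r -> th <= x r ->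
  r + tau * ln (x r / th) <= b -> on_start (r + tau * ln (x r / th)).
Proof.
move=> avr ar thr; set d := tau * _ => rb.
have xr0 : 0 < x r by exact: lt_le_trans thr.
have d0 : 0 <= d.
  by rewrite mulr_ge0 ?(ltW tau_gt0)// ln_ge0// ler_pdivlMr// mul1r.
have decay t : x r * expR (- (t - r) / tau) = th * expR ((r + d - t) / tau).
  have -> : (r + d - t) / tau = ln (x r / th) + - (t - r) / tau.
    by rewrite /d; field; rewrite gt_eqF.
  rewrite expRD lnK ?posrE ?divr_gt0// mulrA; congr (_ * _).
  by field; rewrite gt_eqF.
have nos s : starts s -> r <= s -> r + d <= s.
  move=> ss rs; rewrite leNgt; apply/negP => sd.
  (* Free decay is known only up to the first start, which would find the state still above [th]. *)
  have [s1 [ss1 rs1 s1s first]] := first_start ss rs.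
  have /(run_assign run)[_ _ _] := ss1.
  rewrite u_th (state_idle avr rs1 first) -mulNr decay leNgt => /negP; apply.
  rewrite ltr_pMr// expR_gt1 divr_gt0//; lra.
have rd : r <= r + d by lra.
have xd : x (r + d) = th.
  by rewrite (state_idle avr rd nos) -mulNr decay subrr mul0r expR0 mulr1.
split => //; apply: start_of_available; rewrite ?xd//.
  exact: available_idle avr rd nos.
by rewrite rb andbT (le_trans ar).
Qed.

(** With [F] and [E] as below, the service lifts the state from [th] to [th * F / E], by the
    equilibrium equation. The decay back takes [tau * ln (F / E)], which is [1 / L - S th], so the
    whole cycle lasts [1 / L]. *)
Lemma start_cycle r : on_start r -> a <= r -> r + L^-1 <= b ->
  on_start (r + L^-1).
Proof.
move=> [sr xr] ar rb.
set F := expR (1 / (L * tau)); set E := expR (S th / tau).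
have E0 : 0 < E by exact: expR_gt0.
have EF : E = 1 - (1 - F) * th by exact: expR_service_th.
have F1 : 1 < F by rewrite expR_gt1 divr_gt0// mulr_gt0.
have t0 := th_gt0; have t1 := th_lt1.
have xe : x (r + S th) = th * F / E.
  have := state_service_end sr; rewrite xr => ->.
  rewrite expRN -/E EF; field; rewrite -EF; exact: lt0r_neq0.
(* [E] is the convex combination of 1 and [F] with weight [th] on [F]. *)
have EleF : E <= F by nra.
have the : th <= x (r + S th) by rewrite xe ler_pdivlMr// ler_pM2l.
have period : r + S th + tau * ln (x (r + S th) / th) = r + L^-1.
  rewrite xe (_ : th * F / E / th = F / E); last first.
    by field; rewrite !lt0r_neq0.
  rewrite /F /E -expRN -expRD expRK; field.
  by rewrite !lt0r_neq0.
have ave : available (r + S th).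
  by have := service_end_available sr; rewrite xr.
have are : a <= r + S th.
  by have := service_gt0 sr; rewrite xr; lra.
by have := start_after_decay ave are the; rewrite period; apply.
Qed.

Lemma start_cycles r k : on_start r -> a <= r -> r + k%:R / L <= b ->
  on_start (r + k%:R / L).
Proof.
move=> sr ar; elim: k => [|k IH]; first by rewrite mul0r addr0.
rewrite -natr1 mulrDl mul1r addrA => rb.
have Li : 0 < L^-1 by rewrite invr_gt0.
have kL : 0 <= k%:R / L by rewrite divr_ge0// ltW.
by apply: start_cycle => //; [apply: IH; lra|lra].
Qed.

(* As long as the state is below the threshold the server stays busy, and each
   service multiplies [1 - x] by at most [expR (- (m / tau))]. *)
Lemma reaches_threshold k r : available r -> a <= r ->
  (1 - x r) * expR (- (m / tau)) ^+ k < 1 - th ->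
  r + k%:R * M + tau * ln th^-1 <= b ->
  exists r', [/\ r <= r', r' <= r + k%:R * M + tau * ln th^-1 & on_start r'].
Proof.
have M0 := service_bound_ge0.
have d0 := decay_time_ge0.
have decayed s : available s -> th <= x s ->
    tau * ln (x s / th) <= tau * ln th^-1.
  move=> [s0 _] ths; have := run_state run s0.
  rewrite in_itv/= => /andP[_ xs1].
  rewrite ler_pM2l// ler_ln ?posrE ?invr_gt0 ?divr_gt0//.
    by rewrite ler_piMl// invr_ge0 ltW.
  exact: lt_le_trans ths.
elim: k r => [|k IH] r avr ar; have [thr|rth] := leP th (x r).
- move=> _; rewrite mul0r addr0 => rb; have dr := decayed _ avr thr.
  exists (r + tau * ln (x r / th)); split.
  + by rewrite lerDl mulr_ge0 ?(ltW tau_gt0)// ln_ge0// ler_pdivlMr// mul1r.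
  + by rewrite lerD2l.
  + by apply: start_after_decay => //; lra.
(* For [k = 0] the closeness hypothesis contradicts [x r < th]. *)
- by rewrite expr0 mulr1; lra.
- move=> _ rb; have dr := decayed _ avr thr.
  have kM : 0 <= k.+1%:R * M by rewrite mulr_ge0.
  exists (r + tau * ln (x r / th)); split.
  + by rewrite lerDl mulr_ge0 ?(ltW tau_gt0)// ln_ge0// ler_pdivlMr// mul1r.
  + by lra.
  + by apply: start_after_decay => //; lra.
rewrite exprS mulrA -natr1 [(k%:R + 1) * M]mulrDl mul1r => close rb.
have kM : 0 <= k%:R * M by rewrite mulr_ge0.
have sr : starts r.
  by apply: start_of_available => //; [rewrite ar/=; lra|exact: ltW].
have x01 := run_state run (start_ge0 sr).
have Sm := service_ge sr; have SM := S_le x01; have S0 := service_gt0 sr.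
have xe := state_service_end sr.
have [||||r' [? ? ?]] := IH (r + S (x r)).
- exact: service_end_available.
- lra.
- rewrite xe; apply: le_lt_trans close; apply: ler_wpM2r.
    by rewrite exprn_ge0// expR_ge0.
  have -> : 1 - (1 + (x r - 1) * expR (- (S (x r) / tau)))
      = (1 - x r) * expR (- (S (x r) / tau)) by ring.
  apply: ler_wpM2l; first by have := th_lt1; lra.
  by rewrite ler_expR lerN2 ler_pM2r ?invr_gt0.
- lra.
- by exists r'; split => //; lra.
Qed.

Lemma available_within : exists r, [/\ available r, a <= r & r <= a + M].
Proof.
have M0 := service_bound_ge0.
have [[s /= ss]|nocc] := pselect (occupied S x starts a).
  rewrite in_itv/= => /andP[sa aS].
  exists (s + S (x s)); split; [exact: service_end_available|exact: ltW|].
  have SM := S_le (run_state run (start_ge0 ss)); lra.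
by exists a; split => //; lra.
Qed.

(** The time lost is at most [M] for a service under way at [a], [k * M] to climb past the threshold
    and [tau * ln th^-1] for the first decay; from then on a service starts every [1 / L]. *)
Lemma card_starts_ge k : expR (- (m / tau)) ^+ k < 1 - th ->
  L * (b - a) - L * (M + k%:R * M + tau * ln th^-1)
  <= #|` fset_set (starts `&` `[a, b])|%:R.
Proof.
move=> kth.
have [short|long] := ltP (b - a) (M + k%:R * M + tau * ln th^-1).
  apply: le_trans (ler0n _ _).
  by rewrite -mulrBr mulr_ge0_le0 ?(ltW L_gt0)//; lra.
have [r0 [avr ar0 r0a]] := available_within.
have := run_state run avr.1; rewrite in_itv/= => /andP[xr0 xr1].
have close : (1 - x r0) * expR (- (m / tau)) ^+ k < 1 - th.
  apply: le_lt_trans kth; apply: ler_piMl; last by lra.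
  by rewrite exprn_ge0// expR_ge0.
have [|r [r0r rr0 sr]] := reaches_threshold avr ar0 close; first lra.
have ar := le_trans ar0 r0r.
(* [n] full periods fit between [r] and [b], giving [n + 1] starts, and [(b - r) * L < n + 1]. *)
have rb : 0 <= (b - r) * L by rewrite mulr_ge0 ?(ltW L_gt0)//; lra.
have /andP[nle nlt] := truncn_itv rb; set n := Num.truncn _ in nle nlt.
have nb : r + n%:R * L^-1 <= b by rewrite -lerBrDl ler_pdivrMr.
have Li : 0 < L^-1 by rewrite invr_gt0.
have cyc i : (i <= n)%N -> starts (r + i%:R * L^-1).
  move=> le_in; have [] // := @start_cycles r i sr ar.
  by apply: le_trans nb; rewrite lerD2l ler_pM2r ?invr_gt0// ler_nat.
have := card_starts_progression Li a_ge0 ar nb cyc.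
rewrite -(@ler_nat R) => card_gt.
apply: le_trans card_gt; apply: le_trans (ltW nlt).
by rewrite -mulrBr mulrC ler_pM2r//; lra.
Qed.

End NonemptyQueue.

(** * Bound on the queue length for arrival rates up to [L] *)

Hypothesis lam_gt0 : 0 < lam.
Hypothesis lam_le : lam <= L.

Lemma queue_length_bounded :
  exists C : R, forall t, 0 <= t -> (queue_length lam n0 starts t)%:R <= C.
Proof.
(* Enough services to climb past [th] even from state 0: [k * m / tau] exceeds [- ln (1 - th)]. *)
pose k := (Num.truncn (- ln (1 - th) * tau / m)).+1.
have kth : expR (- (m / tau)) ^+ k < 1 - th.
  have th1 : 0 < 1 - th by have := th_lt1; lra.
  rewrite -expRM_natl -[ltRHS]lnK ?posrE// ltr_expR.
  rewrite mulrN ltrNl mulrA -ltr_pdivrMr ?invr_gt0// invrK.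
  by rewrite -ltr_pdivrMr// truncnS_gt.
pose K := L * (M + k%:R * M + tau * ln th^-1).
have K0 : 0 <= K.
  rewrite mulr_ge0 ?(ltW L_gt0)// addr_ge0 ?decay_time_ge0//.
  by rewrite addr_ge0 ?mulr_ge0 ?service_bound_ge0.
(* [n0] covers a queue that has never been empty. In 3, one unit is for rounding the arrivals up to
   [e] and two are for the arrivals between [e] and [a]. *)
exists (n0%:R + K + 3) => t t0.
have arr_le s : 0 <= s -> (arrivals lam s)%:R <= lam * s.
  by move=> s0; rewrite /arrivals truncn_le mulr_ge0// ltW.
have arr_gt s : lam * s < (arrivals lam s)%:R + 1.
  by rewrite /arrivals natr1 truncnS_gt.
have arrt := arr_le _ t0.
have n0_ge0 : 0 <= n0%:R :> R by [].
rewrite /queue_length; set c := #|` _|.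
suff le_c : (n0 + arrivals lam t)%:R <= n0%:R + K + 3 + c%:R :> R.
  have [/eqP ->|lt_c] := leqP (n0 + arrivals lam t) c; first lra.
  by rewrite natrB ?(ltnW lt_c)//; lra.
rewrite natrD.
(* Services begun before [e] are counted by [c1], those in the final period
   [a, t] of nonempty queue by [c2]; as the supremum [sup E] of the times of
   empty queue need not be attained, the two are separated by at most 2 / L. *)
pose E := [set s | 0 <= s <= t /\ outstanding lam n0 starts s = 0%N].
have [E0|nE] := pselect (E !=set0); last first.
  have queued s : 0 <= s <= t -> (0 < outstanding lam n0 starts s)%N.
    by move=> st; rewrite lt0n; apply/eqP => eq0; apply: nE; exists s.
  have := card_starts_ge (lexx 0) queued kth; rewrite subr0 -/K -/c => le_c.
  have lamt : lam * t <= L * t by rewrite ler_wpM2r.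
  lra.
have ubE : ubound E t by move=> s [/andP[]].
have supE : has_sup E by split => //; exists t.
have Li : 0 < L^-1 by rewrite invr_gt0.
have [e [/andP[e0 et]]] := sup_adherent Li supE.
move=> /eqP; rewrite subn_eq0 -(@ler_nat R) natrD.
set c1 := #|` _| => le_c1 lt_e.
have e_sup : e <= sup E.
  apply: ub_le_sup; first by exists t.
  split; first by rewrite e0.
  by apply/eqP; rewrite subn_eq0 -(@ler_nat R) natrD.
set a := sup E + L^-1.
have a0 : 0 <= a by rewrite /a; lra.
have queued s : a <= s <= t -> (0 < outstanding lam n0 starts s)%N.
  move=> /andP[as_ st]; rewrite lt0n; apply/eqP => eq0.
  have : s <= sup E.
    apply: ub_le_sup; [by exists t|split => //].
    by rewrite st (le_trans a0).
  by move: as_; rewrite /a; lra.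
have := card_starts_ge a0 queued kth; rewrite -/K; set c2 := #|` _| => le_c2.
have ea : e <= a by rewrite /a; lra.
have := card_starts_cat ea et a0; rewrite -/c1 -/c2 -/c -(@ler_nat R) natrD.
have := arr_gt e.
have lam2 : lam * (a - e) <= 2.
  apply: (@le_trans _ _ (L * (2 / L))).
    apply: ler_pM; rewrite ?(ltW lam_gt0) ?subr_ge0// /a.
    lra.
  by rewrite mulrCA divff ?mulr1 ?gt_eqF.
have lamta : lam * (t - a) <= c2%:R + K.
  (* [a] lies beyond [sup E] and may exceed [t]; the left side is then at most 0. *)
  have [ta|ta] := leP a t.
    apply: le_trans (_ : L * (t - a) <= _); last lra.
    by rewrite ler_wpM2r// subr_ge0.
  have c20 : 0 <= c2%:R :> R by [].
  apply: (@le_trans _ _ 0); last lra.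
  by rewrite mulr_ge0_le0 ?(ltW lam_gt0)//; lra.
lra.
Qed.
End QueueRun.

Theorem mainTheorem2 (R : realType) (S : R -> R)
    (S_gt0 : forall x : R, x \in `[0, 1] -> 0 < S x)
    (S_cont : {within `[0, 1], continuous S})
    (S_convex : convex_function (`[0, 1]%classic : set R) S)
    (tau x0 : R) (n0 : nat) (lam : R)
    (tau_gt0 : 0 < tau) (x0_01 : x0 \in `[0, 1])
    (lam_gt0 : 0 < lam) (lam_le : lam <= lambda_eq_max S tau)
    (x_th_lt1 : x_th S tau < 1)
    (x : R -> R) (starts : set R)
    (run : dynamical_queue_run S tau lam x0 n0 (threshold_policy S tau x)
             x starts) :
  (limf_esup (fun t : R => ((queue_length lam n0 starts t)%:R : R)%:E) +oo_R
     < +oo)%E.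
Proof.
have L_gt0 : 0 < lambda_eq_max S tau := lt_le_trans lam_gt0 lam_le.
(* The default value 0 of [xget] is excluded by [L_gt0]. *)
have [_ eq_nonempty] : equilibrium_rates S tau (lambda_eq_max S tau).
  move: L_gt0; rewrite /lambda_eq_max.
  by case: xgetP => [y _ []//|_]; rewrite ltxx.
have [th01 th_eq] : x_eq S tau (lambda_eq_max S tau) (x_th S tau).
  by case: eq_nonempty => y Hy; rewrite /x_th; exact: xgetI Hy.
have th_gt0 : 0 < x_th S tau.
  move: (th01); rewrite in_itv/= le_eqVlt => /andP[/predU1P[th0|//] _].
  have := S_gt0 _ th01; rewrite th_eq -th0 /equilibrium_time.
  by rewrite mulr0 subr0 ln1 mulr0 ltxx.
(* The extrema of [S] on the unit interval serve as [m] and [M]; positivity of [S] makes [m]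
   positive. *)
have [y y01 S_ge] := EVT_min (ler01 : 0 <= 1 :> R) S_cont.
have [z z01 S_le] := EVT_max (ler01 : 0 <= 1 :> R) S_cont.
have [C leC] := queue_length_bounded tau_gt0 run (S_gt0 _ y01) S_ge S_le
  th_gt0 x_th_lt1 L_gt0 th_eq (fun _ => erefl) lam_gt0 lam_le.
apply: (@le_lt_trans _ _ C%:E); last exact: ltry.
(* The upper limit is an infimum of suprema over neighbourhoods of infinity; the half-line from 0 is
   one on which [C] bounds the queue. *)
apply: ge_ereal_inf; eexists.
  exists `[0, +oo[%classic; last by [].
  by exists 0; split => // t /ltW t0 /=; rewrite in_itv/= t0.
apply: ge_ereal_sup => _ [t /= + <-]; rewrite in_itv/= andbT => t0.
by rewrite lee_fin leC.
Qed.
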